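(* Let $n>1$ be an integer and assume that for every prime number $p$ with $p-1 \mid n-1$ there is an equational proof that every $n$-ring with $p=0$ is commutative. Then there is an equational proof that every $n$-ring is commutative.
   Context: Rings are associative and unital, not necessarily commutative; the zero ring is allowed. For an integer $n>1$, an $n$-ring is a ring in which $x^n=x$ holds for every element $x$. Equational proofs. An algebraic theory $\mathcal{T}$ is given by operation symbols of finite arities and a set of axioms, each an equation between terms. An equational proof of $\sigma=\tau$ in $\mathcal{T}$ (written $\mathcal{T}\vdash\sigma=\tau$) is a deduction by the rules: (1) if $\sigma=\tau$ is an axiom then $\mathcal{T}\vdash\sigma=\tau$; (2) $\mathcal{T}\vdash\sigma=\sigma$; (3) if $\mathcal{T}\vdash\sigma=\tau$ then $\mathcal{T}\vdash\tau=\sigma$; (4) if $\mathcal{T}\vdash\sigma=\tau$ and $\mathcal{T}\vdash\tau=\rho$ then $\mathcal{T}\vdash\sigma=\rho$; (5) if $\rho$ is a term of arity $r$ and $\mathcal{T}\vdash\sigma_i=\tau_i$ for $i=1,\dots,r$, then $\mathcal{T}\vdash\rho(\sigma_1,\dots,\sigma_r)=\rho(\tau_1,\dots,\tau_r)$; (6) if $\sigma,\tau$ are terms of arity $r$ with $\mathcal{T}\vdash\sigma=\tau$, then $\mathcal{T}\vdash\sigma(\rho_1,\dots,\rho_r)=\tau(\rho_1,\dots,\rho_r)$ for all terms $\rho_1,\dots,\rho_r$. The theory of $n$-rings consists of the ring axioms (operations $+,-,0,\cdot,1$) together with the axiom $x^n=x$; ''with $p=0$'' means that the axiom $p\cdot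 1=0$ is added. ''There is an equational proof that every ring of a given kind is commutative'' means that the corresponding theory proves $xy=yx$ for two distinct variables $x,y$. *)

(* Defs.v *)
From mathcomp Require Import all_boot.

Set Implicit Arguments.
Unset Strict Implicit.
Unset Printing Implicit Defensive.

Record signature := Signature {
  symb : Type;
  arity : symb -> nat
}.

(* Terms of arity r, i.e., terms in the variables Var i for i : 'I_r. *)
Inductive term (S : signature) (r : nat) : Type :=
| Var (i : 'I_r)
| App (f : symb S) (args : 'I_(arity f) -> term S r).

Arguments Var {S r} i.
Arguments App {S r} f args.

(* subst rho sigma is the composite rho(sigma_1, ..., sigma_r). *)
Fixpoint subst (S : signature) (r m : nat) (rho : term S r)
    (sigma : 'I_r -> term S m) : term S m :=
  match rho with
  | Var i => sigma i
  | App f args => App f (fun j => subst (args j) sigma)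
  end.

(* ax r sigma tau means that the equation sigma = tau between terms of arity r
   is an axiom. *)
Record theory := Theory {
  sig : signature;
  ax : forall r : nat, term sig r -> term sig r -> Prop
}.

Inductive provable (T : theory) :
    forall r : nat, term (sig T) r -> term (sig T) r -> Prop :=
| prov_ax r (s t : term (sig T) r) : ax s t -> provable s t
| prov_refl r (s : term (sig T) r) : provable s s
| prov_sym r (s t : term (sig T) r) : provable s t -> provable t s
| prov_trans r (s t u : term (sig T) r) :
    provable s t -> provable t u -> provable s u
| prov_congr r m (rho : term (sig T) r) (s t : 'I_r -> term (sig T) m) :
    (forall i, provable (s i) (t i)) -> provable (subst rho s) (subst rho t)
| prov_subst r m (s t : term (sig T) r) (rho : 'I_r -> term (sig T) m) :
    provable s t -> provable (subst s rho) (subst t rho).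

Inductive ring_symb := Add | Opp | Zero | Mul | One.

Definition ring_arity (f : ring_symb) : nat :=
  match f with
  | Add | Mul => 2
  | Opp => 1
  | Zero | One => 0
  end.

Definition ring_sig : signature := Signature ring_arity.

Section RingTerms.

Variable r : nat.
Local Notation rterm := (term ring_sig r).

Definition tadd (a b : rterm) : rterm :=
  @App ring_sig r Add (tnth [tuple a; b]).
Definition topp (a : rterm) : rterm := @App ring_sig r Opp (tnth [tuple a]).
Definition tzero : rterm := @App ring_sig r Zero (tnth [tuple]).
Definition tmul (a b : rterm) : rterm :=
  @App ring_sig r Mul (tnth [tuple a; b]).
Definition tone : rterm := @App ring_sig r One (tnth [tuple]).

Definition texp (a : rterm) (n : nat) : rterm := iter n (tmul a) tone.
Definition tnatmul (n : nat) (a : rterm) : rterm := iter n (tadd a) tzero.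

End RingTerms.

Arguments tzero {r}.
Arguments tone {r}.

Definition var (r k : nat) (lt_kr : k < r) : term ring_sig r :=
  Var (Ordinal lt_kr).

Inductive ring_ax : forall r : nat,
    term ring_sig r -> term ring_sig r -> Prop :=
| ax_addA : let x := @var 3 0 isT in let y := @var 3 1 isT in
    let z := @var 3 2 isT in
    ring_ax (tadd x (tadd y z)) (tadd (tadd x y) z)
| ax_addC : let x := @var 2 0 isT in let y := @var 2 1 isT in
    ring_ax (tadd x y) (tadd y x)
| ax_add0 : let x := @var 1 0 isT in ring_ax (tadd tzero x) x
| ax_addN : let x := @var 1 0 isT in ring_ax (tadd (topp x) x) tzero
| ax_mulA : let x := @var 3 0 isT in let y := @var 3 1 isT in
    let z := @var 3 2 isT in
    ring_ax (tmul x (tmul y z)) (tmul (tmul x y) z)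
| ax_mul1l : let x := @var 1 0 isT in ring_ax (tmul tone x) x
| ax_mul1r : let x := @var 1 0 isT in ring_ax (tmul x tone) x
| ax_mulDl : let x := @var 3 0 isT in let y := @var 3 1 isT in
    let z := @var 3 2 isT in
    ring_ax (tmul (tadd x y) z) (tadd (tmul x z) (tmul y z))
| ax_mulDr : let x := @var 3 0 isT in let y := @var 3 1 isT in
    let z := @var 3 2 isT in
    ring_ax (tmul x (tadd y z)) (tadd (tmul x y) (tmul x z)).

Inductive nring_ax (n : nat) : forall r : nat,
    term ring_sig r -> term ring_sig r -> Prop :=
| nring_ring r (s t : term ring_sig r) : ring_ax s t -> nring_ax n s t
| nring_exp : let x := @var 1 0 isT in nring_ax n (texp x n) x.

Definition nring_theory (n : nat) : theory := Theory (@nring_ax n).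

Inductive nring_char_ax (n p : nat) : forall r : nat,
    term ring_sig r -> term ring_sig r -> Prop :=
| nring_char_nring r (s t : term ring_sig r) :
    nring_ax n s t -> nring_char_ax n p s t
| nring_char_zero : nring_char_ax n p (tnatmul p (@tone 0)) tzero.

Definition nring_char_theory (n p : nat) : theory :=
  Theory (@nring_char_ax n p).

Definition comm_lhs : term ring_sig 2 := tmul (@var 2 0 isT) (@var 2 1 isT).
Definition comm_rhs : term ring_sig 2 := tmul (@var 2 1 isT) (@var 2 0 isT).

Definition nring_proves_comm (n : nat) : Prop :=
  @provable (nring_theory n) 2 comm_lhs comm_rhs.

Definition nring_char_proves_comm (n p : nat) : Prop :=
  @provable (nring_char_theory n p) 2 comm_lhs comm_rhs.

(* Main.v *)
(** Let [e] be the gcd of the numbers [a ^ n - a].  It kills every [n]-ring, it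
    is squarefree since [q ^ 2] does not divide [q ^ n - q], and each prime
    [p] dividing it satisfies [p - 1 %| n - 1] since [F_p] has a primitive root.
    In an [n]-ring [R], commutativity of [R / pR] means that [xy - yx] is a
    multiple of [p], hence is killed by [e / p]; as [e] is squarefree, these
    numbers have gcd [1] when [p] ranges over the prime divisors of [e], so
    [xy = yx].  Applying this to the ring of terms modulo provable equality
    gives an equational proof. *)

Require Import Defs.
From HB Require Import structures.
From mathcomp Require Import all_boot.
From mathcomp Require Import all_algebra all_fingroup all_solvable.
From mathcomp Require Import generic_quotient boolp.

Set Implicit Arguments.
Unset Strict Implicit.
Unset Printing Implicit Defensive.

Import GRing.Theory.

(** * Arithmetic of the numbers [a ^ n - a] *)

(** The unit group of ['F_p] is cyclic of order [p - 1]. A generator [g] satisfies [g ^ n = g], so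
    [g ^ (n - 1) = 1] and its order divides [n - 1]. *)
Lemma prime_sub1_dvdn_expn (p n : nat) : prime p -> 0 < n ->
  (forall a, a < p -> p %| a ^ n - a) -> p - 1 %| n - 1.
Proof.
move=> p_pr n_gt0 dvd_p.
have [g defG] := cyclicP (field_unit_group_cyclic [set: {unit 'F_p}]).
have <- : #[g]%g = p - 1.
  by rewrite orderE -defG card_finField_unit card_Fp // subn1.
rewrite order_dvdn; apply/eqP/val_inj; rewrite FinRing.val_unitX /=.
set x : 'F_p := val g.
have x_unit : (x \is a GRing.unit)%R by apply: (valP g).
have x_exp : (x ^+ n = x)%R.
  have /dvd_p : (x < p)%N by rewrite -[X in (_ < X)%N](Fp_cast p_pr) ltn_ord.
  have [x0|x_gt0] := posnP x.
    have -> : x = 0%R by exact: val_inj.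
    by rewrite expr0n gtn_eqF.
  have le_x : x <= x ^ n by rewrite -{1}[X in X <= _]expn1 leq_pexp2l.
  rewrite (dvdn_pcharf (pchar_Fp p_pr)) natrB // natrX natr_Zp subr_eq0.
  by move/eqP.
by apply: (mulrI x_unit); rewrite -exprS subn1 prednK // x_exp mulr1.
Qed.

(** In [q ^ n - q = q * (q ^ (n - 1) - 1)] the prime [q] divides [q ^ (n - 1)], because [n > 1], and
    therefore not the second factor. *)
Lemma sqr_ndvdn_expn_sub (q n : nat) : prime q -> 1 < n ->
  ~~ (q * q %| q ^ n - q).
Proof.
case: n => [|[|n]] // q_pr _; have q_gt0 := prime_gt0 q_pr.
rewrite expnS -[X in _ - X]muln1 -mulnBr dvdn_pmul2l //.
rewrite dvdn_subr ?expn_gt0 ?q_gt0 ?dvdn_exp // dvdn1.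
by rewrite gtn_eqF // prime_gt1.
Qed.

(** Bezout: [gcdn a b] is an integer combination of [a] and [b]. *)
Lemma mulrn_gcdn_eq0 (V : zmodType) (x : V) (a b : nat) :
  (x *+ a = 0 -> x *+ b = 0 -> x *+ gcdn a b = 0)%R.
Proof.
have [->|a_gt0] := posnP a; first by rewrite gcd0n.
move=> xa xb; have [u v def_g _] := egcdnP b a_gt0.
have := congr1 (GRing.natmul x) def_g.
by rewrite mulrnDr (mulnC u) (mulnC v) !mulrnA xa xb !mul0rn add0r.
Qed.

(** * Congruence modulo [p] in a ring *)

Section EqualityModulo.

Local Open Scope ring_scope.
Variables (R : pzRingType) (p : nat).

(** Congruence modulo the ideal [pR], standing in for equality in [R / pR]. *)
Definition eqmod (a b : R) : Prop := exists u, a = b + u *+ p.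

Lemma eqmod_refl a : eqmod a a.
Proof. by exists 0; rewrite mul0rn addr0. Qed.

Lemma eqmod_sym a b : eqmod a b -> eqmod b a.
Proof. by move=> [u ->]; exists (- u); rewrite mulNrn addrK. Qed.

Lemma eqmod_trans a b c : eqmod a b -> eqmod b c -> eqmod a c.
Proof. by move=> [u ->] [v ->]; exists (v + u); rewrite mulrnDl addrA. Qed.

Lemma eqmodD a b c d : eqmod a b -> eqmod c d -> eqmod (a + c) (b + d).
Proof. by move=> [u ->] [v ->]; exists (u + v); rewrite mulrnDl addrACA. Qed.

Lemma eqmodN a b : eqmod a b -> eqmod (- a) (- b).
Proof. by move=> [u ->]; exists (- u); rewrite mulNrn opprD. Qed.

Lemma eqmodM a b c d : eqmod a b -> eqmod c d -> eqmod (a * c) (b * d).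
Proof.
(* Expand [(b + u *+ p) * (d + v *+ p)] and collect the multiples of [p]. *)
move=> [u ->] [v ->]; exists (b * v + u * (d + v *+ p)).
by rewrite mulrDl mulrDr mulrnDl mulrnAr mulrnAl addrA.
Qed.

End EqualityModulo.

(** * From commutativity modulo primes to commutativity *)

Lemma nring_commutative (R : pzRingType) (n : nat) : 1 < n ->
  (forall x : R, x ^+ n = x)%R ->
  (forall p, prime p -> (p - 1 %| n - 1)%N ->
     forall x y : R, eqmod p (x * y) (y * x))%R ->
  forall x y : R, (x * y = y * x)%R.
Proof.
move=> n_gt1 expR commR x y; apply/eqP; rewrite -subr_eq0; apply/eqP.
set c := (x * y - y * x)%R.
(* The bound [2 ^ n] suffices: [e] divides [2 ^ n - 2 > 0], so [e] and all its prime divisors [p]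
   are at most [2 ^ n], and every [a <= p] occurs in the gcd. The default 0 is neutral for
   [gcdn]. *)
pose e := \big[gcdn/0]_(a < (2 ^ n).+1) (a ^ n - a).
(* This makes the truncated difference [a ^ n - a] a true one, so it can be cast into [R]. *)
have le_exp a : a <= a ^ n.
  by case: a => // a; rewrite -{1}[a.+1]expn1 leq_pexp2l // ltnW.
have e_kill (z : R) : (z *+ e = 0)%R.
  rewrite -mulr_natr [e%:R%R](_ : _ = 0)%R ?mulr0 //.
  apply: (big_ind (fun m => m%:R = 0 :> R)%R) => //.
    by move=> a b; apply: mulrn_gcdn_eq0.
  by move=> a _; rewrite natrB // natrX expR subrr.
have dvd_e a : a <= 2 ^ n -> e %| a ^ n - a.
  by rewrite -ltnS => lt_a; apply: (biggcdn_inf (Ordinal lt_a)).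
have e_dvd2 : e %| 2 ^ n - 2 by apply: dvd_e.
have gt0_2 : 0 < 2 ^ n - 2 by rewrite subn_gt0 -{1}[2]expn1 ltn_exp2l.
have e_gt0 : 0 < e by apply: dvdn_gt0 e_dvd2.
have le_e : e <= 2 ^ n by rewrite (leq_trans (dvdn_leq gt0_2 e_dvd2)) ?leq_subr.
have e_prime p : prime p -> p %| e -> (c *+ (e %/ p) = 0)%R.
  move=> p_pr p_dvd; have le_p := leq_trans (dvdn_leq e_gt0 p_dvd) le_e.
  have [|u def_xy] := commR p p_pr _ x y.
    apply: prime_sub1_dvdn_expn => // [|a lt_ap]; first exact: ltnW.
    by apply: dvdn_trans p_dvd (dvd_e _ _); rewrite (leq_trans (ltnW lt_ap)).
  (* Here [c = u *+ p], so its multiple by [e %/ p] is [u *+ e = 0]. *)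
  by rewrite /c def_xy addrC addKr -mulrnA mulnC divnK // e_kill.
(* If [e = 1] there are no prime divisors and the gcd [f] below would be the default 0; but then
   [c = c *+ e = 0] at once. *)
have [e_le1|e_gt1] := leqP e 1.
  by have := e_kill c; have -> : e = 1 by apply/eqP; rewrite eqn_leq e_le1.
pose f := \big[gcdn/0]_(p < e.+1 | prime p && (p %| e)) (e %/ p).
have f_kill : (c *+ f = 0)%R.
  apply: (big_ind (fun m => c *+ m = 0)%R) => [|a b|p /andP[]] //.
    exact: mulrn_gcdn_eq0.
  exact: e_prime.
have f_dvd p : prime p -> p %| e -> f %| e %/ p.
  move=> p_pr p_dvd; have lt_p : p < e.+1 by rewrite ltnS dvdn_leq.
  by apply: (biggcdn_inf (Ordinal lt_p)) => //=; rewrite p_pr.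
have [f1|f_neq1] := eqVneq f 1; first by rewrite f1 in f_kill.
have f_dvd_e : f %| e.
  apply: dvdn_trans (f_dvd _ (pdiv_prime e_gt1) (pdiv_dvd e)) _.
  exact: dvdn_div (pdiv_dvd e).
have f_gt1 : 1 < f by rewrite ltn_neqAle eq_sym f_neq1 (dvdn_gt0 e_gt0).
(* A prime [q] dividing [f] divides [e], hence also [e %/ q]. So [q * q] divides [e] and therefore
   [q ^ n - q], which is impossible. *)
have q_pr := pdiv_prime f_gt1; set q := pdiv f in q_pr.
have q_dvd : q %| e by apply: dvdn_trans (pdiv_dvd f) f_dvd_e.
have qq_dvd : q * q %| e.
  rewrite -[X in _ %| X](divnK q_dvd) dvdn_pmul2r ?prime_gt0 //.
  exact: dvdn_trans (pdiv_dvd f) (f_dvd q q_pr q_dvd).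
case/negP: (sqr_ndvdn_expn_sub q_pr n_gt1).
by apply: dvdn_trans qq_dvd (dvd_e _ _); rewrite (leq_trans (dvdn_leq _ q_dvd)).
Qed.

(** * Evaluation of terms and soundness modulo [p] *)

Section Evaluation.

Local Open Scope ring_scope.
Variable R : pzRingType.

Definition ring_op (f : ring_symb) : ('I_(ring_arity f) -> R) -> R :=
  match f with
  | Add => fun a => a (@Ordinal 2 0 isT) + a (@Ordinal 2 1 isT)
  | Opp => fun a => - a (@Ordinal 1 0 isT)
  | Zero => fun=> 0
  | Mul => fun a => a (@Ordinal 2 0 isT) * a (@Ordinal 2 1 isT)
  | One => fun=> 1
  end.

Fixpoint eval r (v : 'I_r -> R) (t : term ring_sig r) : R :=
  match t with
  | Var i => v i
  | App f args => @ring_op f (fun j => eval v (args j))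
  end.

Lemma eval_subst r m (v : 'I_m -> R) (rho : term ring_sig r) s :
  eval v (subst rho s) = eval (fun i => eval v (s i)) rho.
Proof.
elim: rho => //= f args IH; congr ring_op; exact: funext.
Qed.

Lemma eval_texp r (v : 'I_r -> R) t n : eval v (texp t n) = eval v t ^+ n.
Proof. by elim: n => [|n IH] //=; rewrite exprS -IH. Qed.

Lemma eval_tnatmul r (v : 'I_r -> R) t n :
  eval v (tnatmul n t) = eval v t *+ n.
Proof. by elim: n => [|n IH] //=; rewrite mulrS -IH. Qed.

Lemma eval_ring_ax r (s t : term ring_sig r) (v : 'I_r -> R) :
  ring_ax s t -> eval v s = eval v t.
Proof.
move=> st; case: st v => /= v.
- exact: addrA.
- exact: addrC.
- exact: add0r.
- exact: addNr.
- exact: mulrA.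
- exact: mul1r.
- exact: mulr1.
- exact: mulrDl.
- exact: mulrDr.
Qed.

(** Every ring operation respects the congruence, hence so does every term; this is what the rule
    [prov_congr] requires. *)
Lemma eqmod_eval p r (t : term ring_sig r) (v w : 'I_r -> R) :
  (forall i, eqmod p (v i) (w i)) -> eqmod p (eval v t) (eval w t).
Proof.
move=> vw; elim: t => [i|[] args IH] /=; first exact: vw.
- by apply: eqmodD; apply: IH.
- by apply: eqmodN; apply: IH.
- exact: eqmod_refl.
- by apply: eqmodM; apply: IH.
- exact: eqmod_refl.
Qed.

(* Soundness for R / pR, without forming the quotient. *)
Lemma eqmod_provable n p : (forall x : R, x ^+ n = x) ->
  forall r (s t : term ring_sig r), @provable (nring_char_theory n p) r s t ->
  forall v : 'I_r -> R, eqmod p (eval v s) (eval v t).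
Proof.
move=> expR r s t; elim=> {r s t} [r s t st|r s|r s t _ IH|r s t u _ IHst _ IHtu
  |r m rho s t _ IH|r m s t rho _ IH] v.
- case: st v => [k a b ab|] v.
    case: ab v => [m c d cd|x] v.
      by rewrite (eval_ring_ax v cd); apply: eqmod_refl.
    by rewrite eval_texp expR; apply: eqmod_refl.
  (* The axiom [p = 0] holds modulo [p], with witness 1. *)
  by exists 1; rewrite eval_tnatmul /= add0r.
- exact: eqmod_refl.
- exact: eqmod_sym.
- exact: eqmod_trans (IHst v) (IHtu v).
- by rewrite !eval_subst; apply: eqmod_eval.
- by rewrite !eval_subst.
Qed.

End Evaluation.

(** * The ring of terms in [r] variables modulo provable equality *)

Section TermRing.

Variables n r : nat.
Local Notation rterm := (term ring_sig r).
Local Notation "s ~ t" := (@provable (nring_theory n) r s t)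
  (at level 70, no associativity).

(** Argument lists are functions on ordinals, so they are compared index by index through functional
    extensionality. *)
Lemma subst_tadd k (a b : term ring_sig k) (s : 'I_k -> rterm) :
  subst (tadd a b) s = tadd (subst a s) (subst b s).
Proof. by congr App; apply: funext => -[[|[|]]]. Qed.

Lemma subst_tmul k (a b : term ring_sig k) (s : 'I_k -> rterm) :
  subst (tmul a b) s = tmul (subst a s) (subst b s).
Proof. by congr App; apply: funext => -[[|[|]]]. Qed.

Lemma subst_topp k (a : term ring_sig k) (s : 'I_k -> rterm) :
  subst (topp a) s = topp (subst a s).
Proof. by congr App; apply: funext => -[[|]]. Qed.

Lemma subst_tzero k (s : 'I_k -> rterm) : subst tzero s = tzero.
Proof. by congr App; apply: funext => -[]. Qed.

Lemma subst_tone k (s : 'I_k -> rterm) : subst tone s = tone.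
Proof. by congr App; apply: funext => -[]. Qed.

Lemma subst_texp k (a : term ring_sig k) (s : 'I_k -> rterm) m :
  subst (texp a m) s = texp (subst a s) m.
Proof.
elim: m => [|m IH]; first exact: subst_tone.
by rewrite [LHS]subst_tmul IH.
Qed.

Definition substE :=
  (subst_tadd, subst_tmul, subst_topp, subst_tzero, subst_tone, subst_texp).

Lemma provable_inst k (s t : term ring_sig k) (v : k.-tuple rterm) :
  nring_ax n s t -> subst s (tnth v) ~ subst t (tnth v).
Proof. by move=> st; apply: (@prov_subst (nring_theory n)); apply: prov_ax. Qed.

(** The congruence rule applied to the term [x + y]; it lets addition descend to classes. *)
Lemma provable_tadd a b c d : a ~ b -> c ~ d -> tadd a c ~ tadd b d.
Proof.
move=> ab cd.
have := @prov_congr (nring_theory n) 2 r (tadd (@var 2 0 isT) (@var 2 1 isT))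
  (tnth [tuple a; c]) (tnth [tuple b; d]).
by rewrite !substE; apply=> -[[|[|]]].
Qed.

Lemma provable_tmul a b c d : a ~ b -> c ~ d -> tmul a c ~ tmul b d.
Proof.
move=> ab cd.
have := @prov_congr (nring_theory n) 2 r (tmul (@var 2 0 isT) (@var 2 1 isT))
  (tnth [tuple a; c]) (tnth [tuple b; d]).
by rewrite !substE; apply=> -[[|[|]]].
Qed.

Lemma provable_topp a b : a ~ b -> topp a ~ topp b.
Proof.
move=> ab.
have := @prov_congr (nring_theory n) 1 r (topp (@var 1 0 isT))
  (tnth [tuple a]) (tnth [tuple b]).
by rewrite !substE; apply=> -[[|]].
Qed.

(** The quotient construction takes a boolean relation on a choice type; classical logic supplies
    both. *)
Definition cterm : Type := rterm.
HB.instance Definition _ := gen_eqMixin cterm.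
HB.instance Definition _ := gen_choiceMixin cterm.

Definition provableb (s t : cterm) : bool := `[< s ~ t >].

Lemma provableb_equiv : equiv_class_of provableb.
Proof.
split=> [s|s t|t s u].
- by apply/asboolP; apply: prov_refl.
- by apply/asboolP/asboolP => st; apply: prov_sym.
- by move=> /asboolP st /asboolP tu; apply/asboolP; apply: prov_trans st tu.
Qed.

Canonical provable_equiv := EquivRelPack provableb_equiv.

Local Open Scope quotient_scope.

Definition term_ring := {eq_quot provable_equiv}.
HB.instance Definition _ := Choice.on term_ring.

Definition cls (t : rterm) : term_ring := \pi_term_ring (t : cterm).

(** The bridge between identities in the quotient and equational proofs, used in both directions. *)
Lemma clsP s t : cls s = cls t <-> s ~ t.
Proof.
split=> [/eqP|st]; first by rewrite eqmodE => /asboolP.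
by apply/eqP; rewrite eqmodE; apply/asboolP.
Qed.

Lemma cls_surj (x : term_ring) : exists t, x = cls t.
Proof. by exists (repr x); rewrite /cls reprK. Qed.

Lemma repr_cls t : (repr (cls t) : rterm) ~ t.
Proof. by apply/clsP; rewrite /cls reprK. Qed.

(** The operations act on chosen representatives; [qaddE] and its analogues show that the choice is
    immaterial. *)
Definition qadd (x y : term_ring) := cls (tadd (repr x : rterm) (repr y)).
Definition qmul (x y : term_ring) := cls (tmul (repr x : rterm) (repr y)).
Definition qopp (x : term_ring) := cls (topp (repr x : rterm)).

Lemma qaddE s t : qadd (cls s) (cls t) = cls (tadd s t).
Proof. by apply/clsP; apply: provable_tadd; apply: repr_cls. Qed.

Lemma qmulE s t : qmul (cls s) (cls t) = cls (tmul s t).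
Proof. by apply/clsP; apply: provable_tmul; apply: repr_cls. Qed.

Lemma qoppE s : qopp (cls s) = cls (topp s).
Proof. by apply/clsP; apply: provable_topp; apply: repr_cls. Qed.

(** Like each ring law below, this is an axiom instantiated at representatives of the classes. *)
Lemma qaddA : associative qadd.
Proof.
move=> x y z; have [a ->] := cls_surj x; have [b ->] := cls_surj y.
have [c ->] := cls_surj z.
rewrite !qaddE; apply/clsP.
by have := provable_inst [tuple a; b; c] (nring_ring n ax_addA); rewrite !substE.
Qed.

Lemma qaddC : commutative qadd.
Proof.
move=> x y; have [[a ->] [b ->]] := (cls_surj x, cls_surj y).
rewrite !qaddE; apply/clsP.
by have := provable_inst [tuple a; b] (nring_ring n ax_addC); rewrite !substE.
Qed.

Lemma qadd0 : left_id (cls tzero) qadd.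
Proof.
move=> x; have [a ->] := cls_surj x; rewrite qaddE; apply/clsP.
by have := provable_inst [tuple a] (nring_ring n ax_add0); rewrite !substE.
Qed.

Lemma qaddN : left_inverse (cls tzero) qopp qadd.
Proof.
move=> x; have [a ->] := cls_surj x; rewrite qoppE qaddE; apply/clsP.
by have := provable_inst [tuple a] (nring_ring n ax_addN); rewrite !substE.
Qed.

Lemma qmulA : associative qmul.
Proof.
move=> x y z; have [a ->] := cls_surj x; have [b ->] := cls_surj y.
have [c ->] := cls_surj z.
rewrite !qmulE; apply/clsP.
by have := provable_inst [tuple a; b; c] (nring_ring n ax_mulA); rewrite !substE.
Qed.

Lemma qmul1l : left_id (cls tone) qmul.
Proof.
move=> x; have [a ->] := cls_surj x; rewrite qmulE; apply/clsP.
by have := provable_inst [tuple a] (nring_ring n ax_mul1l); rewrite !substE.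
Qed.

Lemma qmul1r : right_id (cls tone) qmul.
Proof.
move=> x; have [a ->] := cls_surj x; rewrite qmulE; apply/clsP.
by have := provable_inst [tuple a] (nring_ring n ax_mul1r); rewrite !substE.
Qed.

Lemma qmulDl : left_distributive qmul qadd.
Proof.
move=> x y z; have [a ->] := cls_surj x; have [b ->] := cls_surj y.
have [c ->] := cls_surj z.
rewrite !(qmulE, qaddE); apply/clsP.
by have := provable_inst [tuple a; b; c] (nring_ring n ax_mulDl); rewrite !substE.
Qed.

Lemma qmulDr : right_distributive qmul qadd.
Proof.
move=> x y z; have [a ->] := cls_surj x; have [b ->] := cls_surj y.
have [c ->] := cls_surj z.
rewrite !(qmulE, qaddE); apply/clsP.
by have := provable_inst [tuple a; b; c] (nring_ring n ax_mulDr); rewrite !substE.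
Qed.

HB.instance Definition _ :=
  GRing.isZmodule.Build term_ring qaddA qaddC qadd0 qaddN.
HB.instance Definition _ :=
  GRing.Zmodule_isPzRing.Build term_ring qmulA qmul1l qmul1r qmulDl qmulDr.

Lemma cls_tmul s t : cls (tmul s t) = (cls s * cls t)%R.
Proof. by rewrite -qmulE. Qed.

Lemma cls_texp t m : cls (texp t m) = (cls t ^+ m)%R.
Proof. by elim: m => [|m IH] //; rewrite exprS -IH -cls_tmul. Qed.

Lemma term_ring_exp (x : term_ring) : (x ^+ n = x)%R.
Proof.
have [a ->] := cls_surj x; rewrite -cls_texp; apply/clsP.
by have := provable_inst [tuple a] (nring_exp n); rewrite !substE.
Qed.

End TermRing.

Theorem theorem1p1 (n : nat) (n_gt1 : 1 < n)
    (Hp : forall p : nat, prime p -> p - 1 %| n - 1 ->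
            nring_char_proves_comm n p) :
  nring_proves_comm n.
Proof.
(* The goal becomes that the classes of the two variables commute in the term ring on two variables,
   which is an [n]-ring. *)
apply/clsP; rewrite !cls_tmul; apply: nring_commutative (n_gt1) _ _ _ _.
  exact: term_ring_exp.
move=> p p_pr p_dvd x y.
(* Soundness is applied to the assumed proof for [p], with its two variables evaluated at [x] and
   [y]. *)
exact: (eqmod_provable (@term_ring_exp n 2) (Hp p p_pr p_dvd)
          (tnth [tuple x; y])).
Qed.
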